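(* Let $N > 4$ be an integer, let $U$ be a binary quantic of order $N$ in the symplectic coordinates $(p,q)$, and let $H$, $S$, $T$ be its normalized covariants as defined in the context. Then the scalar multiple $$\Phi = -[N(N-2)]^2 H$$ of the Hessian satisfies the first-order differential equation $$\overset{\circ}{\Phi}\,^2 = 4\Phi^3 - N^4(N-2)^4\, U^2 S\,\Phi - N^6(N-2)^6\, U^3 T$$ along each Hamilton curve of $U$; that is, for every Hamilton curve $\gamma$ of $U$, the functions $\Phi\circ\gamma$, $U\circ\gamma$, $S\circ\gamma$, $T\circ\gamma$ satisfy this equation, where $\overset{\circ}{\Phi}$ denotes the derivative of $\Phi\circ\gamma$ with respect to time.
   Context: Work over $\mathbb{K}=\mathbb{R}$ or $\mathbb{C}$. A (binary) quantic of order $N$ is a homogeneous polynomial of degree $N$ in $(p,q)$, written $U=\sum_{n=0}^{N}\binom{N}{n}a_n p^{N-n}q^n$ with $a_n\in\mathbb{K}$. Subscripts $p,q$ denote partial derivatives. Normalized Hessian $H$: $U_{pp}U_{qq}-U_{pq}^2 = N^2(N-1)^2 H$. Covariants $S$ and $T$: put $A=U_{pppp}$, $B=U_{pppq}$, $C=U_{ppqq}$, $D=U_{pqqq}$, $E=U_{qqqq}$ (so that $(P\partial_p+Q\partial_q)^4U = AP^4+4BP^3Q+6CP^2Q^2+4DPQ^3+EQ^4$). Then $S$ and $T$ are defined by $$AE-4BD+3C^2=[N(N-1)(N-2)(N-3)]^2 S,$$ $$ACE+2BCD-AD^2-B^2E-C^3=[N(N-1)(N-2)(N-3)]^3 T.$$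 A Hamilton curve of $U$ is a solution curve $\gamma=(p,q)$, defined on a connected time domain (an interval if $\mathbb{K}=\mathbb{R}$, a connected open subset of $\mathbb{C}$ if $\mathbb{K}=\mathbb{C}$), of the system $\overset{\circ}{q}=U_p$, $\overset{\circ}{p}=-U_q$, where $^{\circ}$ denotes the time derivative. *)

(* Defs.v *)
From mathcomp Require Import all_boot all_order all_algebra.
From mathcomp Require Import complex.
From mathcomp Require Import all_classical all_reals all_analysis.
(* The notations of mpoly clash with those of mathcomp-analysis. *)
From mathcomp Require Import -(notations) mpoly.

Set Implicit Arguments.
Unset Strict Implicit.
Unset Printing Implicit Defensive.

Import Order.TTheory GRing.Theory Num.Theory.
Import numFieldNormedType.Exports.

Local Open Scope classical_set_scope.
Local Open Scope ring_scope.

(* Polynomials in the two variables (p, q): variable 0 is p, variable 1 is q. *)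
Definition bipoly (K : fieldType) := mpoly 2 K.

Section Covariants.
Context {K : fieldType}.
Implicit Types U F : bipoly K.

Definition is_quantic (N : nat) U : bool :=
  U \is ishomog1 N mdeg.

Definition dp F : bipoly K := mderiv ord0 F.
Definition dq F : bipoly K := mderiv ord_max F.

Definition bieval F (x y : K) : K :=
  meval (fun i : 'I_2 => if i == ord0 then x else y) F.

(* The scalar factors inverted in covH, covS and covT are nonzero in
   characteristic 0 as soon as N > 3, so these are the covariants H, S, T with
   U_pp U_qq - U_pq^2 = N^2 (N-1)^2 H, and similarly for S and T. *)
Definition covH (N : nat) U : bipoly K :=
  (N%:R ^+ 2 * (N%:R - 1) ^+ 2)^-1 *:
    (dp (dp U) * dq (dq U) - dq (dp U) ^+ 2).

Definition falling4 (N : nat) : K :=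
  N%:R * (N%:R - 1) * (N%:R - 2) * (N%:R - 3).

Definition covS (N : nat) U : bipoly K :=
  let A := dp (dp (dp (dp U))) in
  let B := dq (dp (dp (dp U))) in
  let C := dq (dq (dp (dp U))) in
  let D := dq (dq (dq (dp U))) in
  let E := dq (dq (dq (dq U))) in
  (falling4 N ^+ 2)^-1 *: (A * E - 4 * (B * D) + 3 * C ^+ 2).

Definition covT (N : nat) U : bipoly K :=
  let A := dp (dp (dp (dp U))) in
  let B := dq (dp (dp (dp U))) in
  let C := dq (dq (dp (dp U))) in
  let D := dq (dq (dq (dp U))) in
  let E := dq (dq (dq (dq U))) in
  (falling4 N ^+ 3)^-1 *:
    (A * C * E + 2 * (B * C * D) - A * D ^+ 2 - B ^+ 2 * E - C ^+ 3).

Definition covPhi (N : nat) U : bipoly K :=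
  - ((N%:R * (N%:R - 2)) ^+ 2 *: covH N U).

End Covariants.

(* K is R or C, where C is R[i]. *)
Variant scalars := RealScalars | ComplexScalars.

Definition scalar_field (R : realType) (s : scalars) : numFieldType :=
  match s with
  | RealScalars => R
  | ComplexScalars => R[i]
  end.

(* Real time domains are intervals of any kind with at least two points (on a
   single point, derivatives are meaningless); complex ones are connected and
   open. *)
Definition time_domain (R : realType) (s : scalars) :
    set (scalar_field R s) -> Prop :=
  match s return set (scalar_field R s) -> Prop with
  | RealScalars => fun I : set R =>
      is_interval I /\ exists a b : R, [/\ I a, I b & a < b]
  | ComplexScalars => fun D : set (R[i] : numFieldType) =>
      open D /\ connected D
  end.

(* The derivative of f at t relative to D: the limit of the difference
   quotients over s in D, s <> t. It is the ordinary (real or complex)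
   derivative at interior points of D, and the one-sided one at an end point
   of a real interval. *)
Definition derivative_within (K : numFieldType) (D : set K) (f : K -> K)
    (t l : K) : Prop :=
  (fun s : K => (f s - f t) / (s - t)) @ within D (dnbhs t) --> l.

Definition hamilton_curve (R : realType) (s : scalars)
    (U : bipoly (scalar_field R s)) (D : set (scalar_field R s))
    (p q : scalar_field R s -> scalar_field R s) : Prop :=
  time_domain D /\
  forall t, D t ->
    derivative_within D q t (bieval (dp U) (p t) (q t)) /\
    derivative_within D p t (- bieval (dq U) (p t) (q t)).

(* Main.v *)
Require Import Defs.
From mathcomp Require Import all_boot all_order all_algebra.
From mathcomp Require Import complex.
From mathcomp Require Import all_classical all_reals all_analysis.
From mathcomp Require Import -(notations) mpoly.
From mathcomp Require Import ring.
Set Implicit Arguments.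
Unset Strict Implicit.
Unset Printing Implicit Defensive.

Import Order.TTheory GRing.Theory Num.Theory.
Import numFieldNormedType.Exports.
Local Open Scope classical_set_scope.
Local Open Scope ring_scope.

(** The equation is the syzygy between the covariants of a binary quartic,
    read along the flow.

    Along a Hamilton curve the derivative of a polynomial F(p, q) is
    F_q U_p - F_p U_q ([derivative_within_bieval]); for F = Phi it is, up to a
    constant, the Jacobian of U and its Hessian.  So the claim is an algebraic
    identity at each point (x, y), relating the derivatives of U there.

    Let a, b, c, d, e be the values at (x, y) of the fourth derivatives of U.
    All derivatives of U of lower order are homogeneous, so iterating Euler's
    identity expresses their values at (x, y), and that of U itself, through
    a, ..., e, x and y alone ([quantic_expand1] to [quantic_expand4]).  Up to
    constants depending on N, these expressions are the polar forms at (x, y)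
    of the quartic f with coefficients (a, b, c, d, e).  Hence U, its
    gradient, its Hessian and the flow of its Hessian take at (x, y) the same
    values, up to constants, as the corresponding covariants of f, while S and
    T are multiples of the invariants I and J of f.  These satisfy the
    classical relation
      flow^2 = - 4 h^3 + I f^2 h - J f^3
    ([quartic_syzygy]), and what remains is to see that the constants in the
    statement are those produced by the rescaling ([rescaled_syzygy]). *)

(** * Derivatives relative to a set *)

Section DerivativeWithin.
Context {K : numFieldType}.
Implicit Types (D : set K) (f g : K -> K) (t a b c : K).

Lemma derivative_within_cst D c t : derivative_within D (fun=> c) t 0.
Proof.
rewrite /derivative_within; under eq_fun do rewrite subrr mul0r.
exact: cvg_cst.
Qed.

Lemma derivative_withinD D f g t a b :
  derivative_within D f t a -> derivative_within D g t b ->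
  derivative_within D (fun x => f x + g x) t (a + b).
Proof.
rewrite /derivative_within => fa gb; apply: cvg_trans (cvgD fa gb).
apply: near_eq_cvg; apply: nearW => x.
by rewrite !fctE /= -mulrDl; congr (_ * _); ring.
Qed.

(** Since f x = (f x - f t) / (x - t) * (x - t) + f t for x <> t. *)
Lemma derivative_within_continuous D f t a :
  derivative_within D f t a -> f @ within D (dnbhs t) --> f t.
Proof.
move=> fa.
have id_cvg : (fun x : K => x - t) @ within D (dnbhs t) --> (0 : K).
  rewrite -[X in _ --> X](subrr t).
  have id_cvg : id @ within D (dnbhs t) --> t.
    have within_nbhs : within D (dnbhs t) `=>` nbhs t.
      exact: cvg_trans (cvg_within _) (cvg_within _).
    exact: within_nbhs.
  exact: cvgB id_cvg (cvg_cst t).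
have lim : (fun x => (f x - f t) / (x - t) * (x - t) + f t)
    @ within D (dnbhs t) --> f t.
  rewrite -[X in _ --> X]add0r -[X in _ --> X + _](mulr0 a).
  exact: cvgD (cvgM fa id_cvg) (cvg_cst (f t)).
apply: cvg_trans lim; apply: near_eq_cvg.
rewrite near_withinE near_withinE; apply: nearW => x xt _ /=.
by rewrite divfK ?subrK // subr_eq0.
Qed.

Lemma derivative_withinM D f g t a b :
  derivative_within D f t a -> derivative_within D g t b ->
  derivative_within D (fun x => f x * g x) t (a * g t + f t * b).
Proof.
move=> fa gb; have gt := derivative_within_continuous gb.
apply: cvg_trans (cvgD (cvgM fa gt) (cvgM (cvg_cst (f t)) gb)).
apply: near_eq_cvg; apply: nearW => x.
by rewrite !fctE /=; ring.
Qed.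

End DerivativeWithin.

(** * Polynomials along a curve *)

(** The induction by which the chain rule reduces to the sum and product
    rules: induction on monomials would leave their products to be treated
    apart. *)
Lemma bipoly_ind (K : fieldType) (P : bipoly K -> Prop) :
  (forall c, P (mpolyC 2 c)) -> (forall i, P (mpolyX K (mnm1 i))) ->
  (forall F G, P F -> P G -> P (F + G)) ->
  (forall F G, P F -> P G -> P (F * G)) -> forall F, P F.
Proof.
move=> PC PX PD PM; elim/mpolyind; first by rewrite -mpolyC0.
move=> c m F _ _ PF; apply: PD => //; rewrite -mul_mpolyC; apply: (PM) => //.
rewrite mpolyXE_id; elim/big_rec: _ => [|i G _ PG]; first exact: (PC 1).
apply: (PM) => //; elim: (m i) => [|k Pk]; first exact: (PC 1).
by rewrite exprS; exact: (PM).
Qed.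

Section Evaluation.
Context {K : fieldType}.
Implicit Types (F G : bipoly K) (x y c : K).

Lemma bievalD F G x y : bieval (F + G) x y = bieval F x y + bieval G x y.
Proof. exact: mevalD. Qed.
Lemma bievalN F x y : bieval (- F) x y = - bieval F x y.
Proof. exact: mevalN. Qed.
Lemma bievalM F G x y : bieval (F * G) x y = bieval F x y * bieval G x y.
Proof. exact: mevalM. Qed.
Lemma bievalX F k x y : bieval (F ^+ k) x y = bieval F x y ^+ k.
Proof. exact: rmorphXn. Qed.
Lemma bieval_nat k x y : bieval k%:R x y = k%:R.
Proof. exact: rmorph_nat. Qed.
Lemma bievalZ c F x y : bieval (c *: F) x y = c * bieval F x y.
Proof. exact: mevalZ. Qed.
(** The order matters: unfolding numerals into sums of ones, or squares into
   products, would let the last rules apply before the first ones. *)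
Definition bievalE :=
  (bieval_nat, bievalX, bievalZ, bievalN, bievalM, bievalD).

End Evaluation.

Lemma mderivU (n : nat) (R : comNzRingType) (i j : 'I_n) :
  mderiv i (mpolyX R (mnm1 j)) = mpolyC n (j == i)%:R.
Proof.
rewrite mderivX mnm1E; have [->|_] := eqVneq j i; last by rewrite scale0r mpolyC0.
rewrite scale1r; set m := (X in mpolyX _ X).
have -> : m = mnm0 by apply/mnmP => k; rewrite mnmBE subnn mnm0E.
exact: mpolyX0.
Qed.

Lemma ord2_cases (i : 'I_2) : i = ord0 \/ i = ord_max.
Proof. by case: i => -[|[|//]] ilt; [left|right]; exact: val_inj. Qed.

Lemma derivative_within_bieval (K : numFieldType) (D : set K) (p q : K -> K)
    (t a b : K) (F : bipoly K) :
  derivative_within D p t a -> derivative_within D q t b ->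
  derivative_within D (fun s => bieval F (p s) (q s)) t
    (bieval (dp F) (p t) (q t) * a + bieval (dq F) (p t) (q t) * b).
Proof.
move=> pa qb; elim/bipoly_ind: F => [c|i|F G hF hG|F G hF hG].
- rewrite /dp /dq !mderivC /bieval !meval0 !mul0r addr0.
  under eq_fun do rewrite mevalC.
  exact: derivative_within_cst.
- rewrite /dp /dq !mderivU /bieval !mevalC; under eq_fun do rewrite mevalXU.
  by case: (ord2_cases i) => ->; rewrite ?mul1r ?mul0r ?addr0 ?add0r.
- rewrite /dp /dq !mderivD; under eq_fun do rewrite bievalD.
  rewrite !bievalD; have := derivative_withinD hF hG.
  by congr derivative_within; ring.
- rewrite /dp /dq !mderivM; under eq_fun do rewrite bievalM.
  rewrite !bievalE; have := derivative_withinM hF hG.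
  by congr derivative_within; ring.
Qed.

(** * Euler's identity and homogeneity *)

(** Each monomial of F is an eigenvector of the Euler operator, with its
    degree as eigenvalue. *)
Lemma euler_mpoly (n : nat) (R : comNzRingType) (d : nat) (F : mpoly n R) :
  F \is ishomog1 d mdeg ->
  \sum_(i < n) mpolyX R (mnm1 i) * mderiv i F = d%:R *: F.
Proof.
move=> /dhomogP dF; rewrite {1}(mpolyE F) [in RHS](mpolyE F).
under eq_bigr do rewrite raddf_sum mulr_sumr.
rewrite exchange_big scaler_sumr; apply: eq_big_seq => m /dF dm.
have {}dm : mdeg m = d by [].
rewrite -dm scalerA mulrC -scalerA mdegE natr_sum scaler_suml scaler_sumr.
apply: eq_bigr => i _ /=; rewrite mderivZ -scalerAr mderivX -scalerAr.
have [->|mi] := eqVneq (m i) 0%N; first by rewrite !scale0r.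
rewrite -mpolyXD addmC submK //; apply/mnm_lepP => j; rewrite mnmE.
by case: eqP => // <-; rewrite lt0n.
Qed.

Lemma dhomog_mderiv (n : nat) (R : comNzRingType) (d : nat) (i : 'I_n)
    (F : mpoly n R) :
  F \is ishomog1 d.+1 mdeg -> mderiv i F \is ishomog1 d mdeg.
Proof.
move=> /dhomogP dF; rewrite (mpolyE F) raddf_sum big_seq.
apply: rpred_sum => m /dF dm; have {}dm : mdeg m = d.+1 by [].
rewrite /= mderivZ rpredZ // mderivX.
have [->|mi] := eqVneq (m i) 0%N; first by rewrite scale0r rpred0.
rewrite rpredZ // dhomogX; apply/eqP/succn_inj.
rewrite -dm -[in RHS](@submK _ (mnm1 i) m).
  by rewrite mdegD mdeg1 addn1.
apply/mnm_lepP => j; rewrite mnmE.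
by case: eqP => // <-; rewrite lt0n.
Qed.

Lemma euler_quantic (K : fieldType) (d : nat) (F : bipoly K) (x y : K) :
  is_quantic d F ->
  d%:R * bieval F x y = x * bieval (dp F) x y + y * bieval (dq F) x y.
Proof.
move=> dF; have := congr1 (fun G => bieval G x y) (euler_mpoly dF).
rewrite bievalZ => <-; rewrite big_ord_recl big_ord1 bievalD !bievalM.
rewrite /bieval !mevalXU /=.
by congr (_ + _ * _); congr meval; congr mderiv; exact: val_inj.
Qed.

Lemma dp_dq (K : fieldType) (F : bipoly K) : dp (dq F) = dq (dp F).
Proof. exact: mderiv_comm. Qed.

Lemma quantic_dp (K : fieldType) (d : nat) (F : bipoly K) :
  is_quantic d.+1 F -> is_quantic d (dp F).
Proof. exact: dhomog_mderiv. Qed.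

Lemma quantic_dq (K : fieldType) (d : nat) (F : bipoly K) :
  is_quantic d.+1 F -> is_quantic d (dq F).
Proof. exact: dhomog_mderiv. Qed.

(** * The syzygy of the binary quartic *)

Section Forms.
Context {K : comNzRingType}.
Implicit Types a b c d e u x y : K.

(** The general binary forms, with binomial coefficients: quadratic_form is
    a x^2 + 2 b x y + c y^2, and so on.  Their recursive shape is the one in
    which iterated use of Euler's identity produces them. *)
Definition linear_form a b x y := x * a + y * b.
Definition quadratic_form a b c x y :=
  linear_form (linear_form a b x y) (linear_form b c x y) x y.
Definition cubic_form a b c d x y :=
  linear_form (quadratic_form a b c x y) (quadratic_form b c d x y) x y.
Definition quartic_form a b c d e x y :=
  linear_form (cubic_form a b c d x y) (cubic_form b c d e x y) x y.

(** The classical invariants of the binary quartic, of degrees 2 and 3; the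
    second one is the determinant of the Hankel matrix of (a, ..., e). *)
Definition quartic_I a b c d e := a * e - 4 * (b * d) + 3 * c ^+ 2.
Definition quartic_J a b c d e :=
  a * c * e + 2 * (b * c * d) - a * d ^+ 2 - b ^+ 2 * e - c ^+ 3.

(** The derivative of u11 u22 - u12^2 along the Hamiltonian field (- u2, u1),
    when the variables stand for the partial derivatives of u up to order 3. *)
Definition hessian_flow u1 u2 u11 u12 u22 u111 u112 u122 u222 :=
  u1 * (u112 * u22 + u11 * u222 - 2 * (u122 * u12))
  - u2 * (u111 * u22 + u11 * u122 - 2 * (u112 * u12)).

(** Both sides are covariants of the quartic, so the relation amounts to its
    instance at (x, y) = (1, 0), a relation between seminvariants: there
    f = a, h = a c - b^2 and the flow is a^2 d - 3 a b c + 2 b^3.  Direct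
    expansion proves it at every point at once. *)
Lemma quartic_syzygy a b c d e x y :
  let f := quartic_form a b c d e x y in
  let f1 := cubic_form a b c d x y in
  let f2 := cubic_form b c d e x y in
  let f11 := quadratic_form a b c x y in
  let f12 := quadratic_form b c d x y in
  let f22 := quadratic_form c d e x y in
  let f111 := linear_form a b x y in
  let f112 := linear_form b c x y in
  let f122 := linear_form c d x y in
  let f222 := linear_form d e x y in
  let h := f11 * f22 - f12 ^+ 2 in
  hessian_flow f1 f2 f11 f12 f22 f111 f112 f122 f222 ^+ 2 =
    - 4 * h ^+ 3 + quartic_I a b c d e * f ^+ 2 * h
    - quartic_J a b c d e * f ^+ 3.
Proof.
rewrite /hessian_flow /quartic_I /quartic_J.
rewrite /quartic_form /cubic_form /quadratic_form /linear_form /=.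
ring.
Qed.
End Forms.

(** * A quantic in terms of its fourth derivatives *)

Lemma linear_form_div (K : fieldType) (a b u v x y : K) :
  linear_form (a / u) (b / u) x y / v = linear_form a b x y / (v * u).
Proof. by rewrite /linear_form invfM; ring. Qed.

Section QuanticExpansion.
Context {K : numFieldType}.
Variables x y : K.
Implicit Types F : bipoly K.
Local Notation ev F := (bieval F x y).

(** Euler's identity, solved for the value of F: the degree n + 1 is invertible
    in characteristic zero.  The next three lemmas iterate it. *)
Lemma quantic_expand1 n F : is_quantic n.+1 F ->
  ev F = linear_form (ev (dp F)) (ev (dq F)) x y / n.+1%:R.
Proof.
by move=> hF; rewrite /linear_form -(euler_quantic _ _ hF) mulrC mulKf.
Qed.

Lemma quantic_expand2 n F : is_quantic n.+2 F ->
  ev F = quadratic_form (ev (dp (dp F))) (ev (dq (dp F))) (ev (dq (dq F))) x y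
         / (n.+2%:R * n.+1%:R).
Proof.
move=> hF; rewrite (quantic_expand1 hF).
rewrite (quantic_expand1 (quantic_dp hF)) (quantic_expand1 (quantic_dq hF)).
rewrite !dp_dq; exact: linear_form_div.
Qed.

Lemma quantic_expand3 n F : is_quantic n.+3 F ->
  ev F = cubic_form (ev (dp (dp (dp F)))) (ev (dq (dp (dp F))))
           (ev (dq (dq (dp F)))) (ev (dq (dq (dq F)))) x y
         / (n.+3%:R * (n.+2%:R * n.+1%:R)).
Proof.
move=> hF; rewrite (quantic_expand1 hF).
rewrite (quantic_expand2 (quantic_dp hF)) (quantic_expand2 (quantic_dq hF)).
rewrite !dp_dq; exact: linear_form_div.
Qed.

Lemma quantic_expand4 n F : is_quantic n.+4 F ->
  ev F = quartic_form (ev (dp (dp (dp (dp F))))) (ev (dq (dp (dp (dp F)))))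
           (ev (dq (dq (dp (dp F))))) (ev (dq (dq (dq (dp F)))))
           (ev (dq (dq (dq (dq F))))) x y
         / (n.+4%:R * (n.+3%:R * (n.+2%:R * n.+1%:R))).
Proof.
move=> hF; rewrite (quantic_expand1 hF).
rewrite (quantic_expand3 (quantic_dp hF)) (quantic_expand3 (quantic_dq hF)).
rewrite !dp_dq; exact: linear_form_div.
Qed.

End QuanticExpansion.

(** * Values of the covariants *)

Section CovariantValues.
Context {K : fieldType}.
Implicit Types (F G U : bipoly K) (c x y : K).

Lemma bieval_hessian c F G H x y :
  bieval (c *: (F * H - G ^+ 2)) x y =
  c * (bieval F x y * bieval H x y - bieval G x y ^+ 2).
Proof. by rewrite !bievalE. Qed.

Lemma bieval_quartic_I c F0 F1 F2 F3 F4 x y :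
  bieval (c *: quartic_I F0 F1 F2 F3 F4) x y =
  c * quartic_I (bieval F0 x y) (bieval F1 x y) (bieval F2 x y)
        (bieval F3 x y) (bieval F4 x y).
Proof. by rewrite /quartic_I !bievalE. Qed.

Lemma bieval_quartic_J c F0 F1 F2 F3 F4 x y :
  bieval (c *: quartic_J F0 F1 F2 F3 F4) x y =
  c * quartic_J (bieval F0 x y) (bieval F1 x y) (bieval F2 x y)
        (bieval F3 x y) (bieval F4 x y).
Proof. by rewrite /quartic_J !bievalE. Qed.

Lemma bieval_mderiv_hessian i c F G H x y :
  bieval (mderiv i (c *: (F * H - G ^+ 2))) x y =
  c * (bieval (mderiv i F) x y * bieval H x y
       + bieval F x y * bieval (mderiv i H) x y
       - 2 * (bieval (mderiv i G) x y * bieval G x y)).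
Proof. by rewrite mderivZ mderivB expr2 !mderivM !bievalE; ring. Qed.

Definition phi_scale (N : nat) : K :=
  - ((N%:R * (N%:R - 2)) ^+ 2 / (N%:R ^+ 2 * (N%:R - 1) ^+ 2)).

Lemma covPhiE N U :
  covPhi N U =
  phi_scale N *: (dp (dp U) * dq (dq U) - dq (dp U) ^+ 2).
Proof. by rewrite /covPhi /covH /phi_scale scalerA scaleNr. Qed.

Lemma covPhi_flow N U x y :
  bieval (dp (covPhi N U)) x y * - bieval (dq U) x y
  + bieval (dq (covPhi N U)) x y * bieval (dp U) x y =
  phi_scale N *
  hessian_flow (bieval (dp U) x y) (bieval (dq U) x y)
    (bieval (dp (dp U)) x y) (bieval (dq (dp U)) x y)
    (bieval (dq (dq U)) x y)
    (bieval (dp (dp (dp U))) x y) (bieval (dq (dp (dp U))) x y)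
    (bieval (dq (dq (dp U))) x y) (bieval (dq (dq (dq U))) x y).
Proof.
rewrite covPhiE [in X in X * _ + _]/dp [in X in _ + X * _]/dq.
rewrite !bieval_mderiv_hessian -!/(dp _) -!/(dq _) !dp_dq /hessian_flow.
ring.
Qed.

End CovariantValues.

(** Here m1, ..., m4 stand for N - 3, ..., N, which enter only as nonzero
    constants.  After division by them, Phi becomes - h / (m1 m3)^2 and its
    flow - flow / (m1 m3)^3, whence the common factor (m1 m3)^-6: the powers of
    m4 m2 in front of the terms in S and T cancel those in the denominators of
    U, S and T, where only powers of m1 m3 remain. *)
Lemma rescaled_syzygy (K : fieldType) (m1 m2 m3 m4 a b c d e x y : K) :
  m1 != 0 -> m2 != 0 -> m3 != 0 -> m4 != 0 ->
  let u := quartic_form a b c d e x y / (m4 * (m3 * (m2 * m1))) in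
  let u1 := cubic_form a b c d x y / (m3 * (m2 * m1)) in
  let u2 := cubic_form b c d e x y / (m3 * (m2 * m1)) in
  let u11 := quadratic_form a b c x y / (m2 * m1) in
  let u12 := quadratic_form b c d x y / (m2 * m1) in
  let u22 := quadratic_form c d e x y / (m2 * m1) in
  let u111 := linear_form a b x y / m1 in
  let u112 := linear_form b c x y / m1 in
  let u122 := linear_form c d x y / m1 in
  let u222 := linear_form d e x y / m1 in
  let k := - ((m4 * m2) ^+ 2 / (m4 ^+ 2 * m3 ^+ 2)) in
  let phi := k * (u11 * u22 - u12 ^+ 2) in
  let S := ((m4 * m3 * m2 * m1) ^+ 2)^-1 * quartic_I a b c d e in
  let T := ((m4 * m3 * m2 * m1) ^+ 3)^-1 * quartic_J a b c d e in
  (k * hessian_flow u1 u2 u11 u12 u22 u111 u112 u122 u222) ^+ 2 =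
    4 * phi ^+ 3 - m4 ^+ 4 * m2 ^+ 4 * u ^+ 2 * S * phi
    - m4 ^+ 6 * m2 ^+ 6 * u ^+ 3 * T.
Proof.
move=> m1nz m2nz m3nz m4nz; have := quartic_syzygy a b c d e x y; cbv zeta.
move: (quartic_form _ _ _ _ _ _ _) (quartic_I _ _ _ _ _) (quartic_J _ _ _ _ _).
move: (cubic_form a b c d x y) (cubic_form b c d e x y).
move: (quadratic_form a b c x y) (quadratic_form b c d x y).
move: (quadratic_form c d e x y).
move: (linear_form a b x y) (linear_form b c x y).
move: (linear_form c d x y) (linear_form d e x y).
move=> f122 f222 f111 f112 f22 f11 f12 f1 f2 f I J syz.
transitivity (hessian_flow f1 f2 f11 f12 f22 f111 f112 f122 f222 ^+ 2
              / (m1 * m3) ^+ 6).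
  by rewrite /hessian_flow; field; rewrite m1nz m2nz m3nz m4nz.
by rewrite syz; field; rewrite m1nz m2nz m3nz m4nz.
Qed.

(** All quantities are those of the quartic frozen at (x, y), up to the
    constants of [rescaled_syzygy].  Writing N as n + 4 makes the factors
    N, ..., N - 3 successors, hence visibly nonzero. *)
Lemma covPhi_flow_syzygy (K : numFieldType) (N : nat) (U : bipoly K)
    (x y : K) : (3 < N)%N -> is_quantic N U ->
  (bieval (dp (covPhi N U)) x y * - bieval (dq U) x y
   + bieval (dq (covPhi N U)) x y * bieval (dp U) x y) ^+ 2 =
  4 * bieval (covPhi N U) x y ^+ 3
  - N%:R ^+ 4 * (N%:R - 2) ^+ 4 * bieval U x y ^+ 2
    * bieval (covS N U) x y * bieval (covPhi N U) x y
  - N%:R ^+ 6 * (N%:R - 2) ^+ 6 * bieval U x y ^+ 3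
    * bieval (covT N U) x y.
Proof.
case: N => [|[|[|[|n]]]] // _ hU; rewrite covPhi_flow.
rewrite covPhiE bieval_hessian /covS /covT /=.
rewrite -/(quartic_I _ _ _ _ _) -/(quartic_J _ _ _ _ _).
rewrite bieval_quartic_I bieval_quartic_J /phi_scale /falling4.
have natr_subl m k : (m + k)%:R - m%:R = k%:R :> K.
  by rewrite natrD addrAC subrr add0r.
have -> : n.+4%:R - 1 = n.+3%:R :> K := natr_subl 1%N n.+3.
have -> : n.+4%:R - 2 = n.+2%:R :> K := natr_subl 2%N n.+2.
have -> : n.+4%:R - 3 = n.+1%:R :> K := natr_subl 3%N n.+1.
have hUp := quantic_dp hU; have hUq := quantic_dq hU.
have hUpp := quantic_dp hUp; have hUpq := quantic_dq hUp.
have hUqq := quantic_dq hUq.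
have eU := quantic_expand4 x y hU.
have eUp := quantic_expand3 x y hUp.
have eUq := quantic_expand3 x y hUq.
have eUpp := quantic_expand2 x y hUpp.
have eUpq := quantic_expand2 x y hUpq.
have eUqq := quantic_expand2 x y hUqq.
have eUppp := quantic_expand1 x y (quantic_dp hUpp).
have eUppq := quantic_expand1 x y (quantic_dq hUpp).
have eUpqq := quantic_expand1 x y (quantic_dq hUpq).
have eUqqq := quantic_expand1 x y (quantic_dq hUqq).
rewrite !dp_dq in eUq eUpq eUqq eUppq eUpqq eUqqq.
rewrite eU eUp eUq eUpp eUpq eUqq eUppp eUppq eUpqq eUqqq.
by apply: rescaled_syzygy; rewrite pnatr_eq0.
Qed.

(** * The differential equation along a Hamilton curve *)

Theorem theorem2 (R : realType) (s : scalars) (N : nat) (hN : (4 < N)%N)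
    (U : bipoly (scalar_field R s)) (hU : is_quantic N U)
    (D : set (scalar_field R s))
    (p q : scalar_field R s -> scalar_field R s)
    (hpq : hamilton_curve U D p q) (t : scalar_field R s) (ht : D t) :
  exists dPhi : scalar_field R s,
    derivative_within D (fun x => bieval (covPhi N U) (p x) (q x)) t dPhi /\
    dPhi ^+ 2 =
      4 * bieval (covPhi N U) (p t) (q t) ^+ 3
      - N%:R ^+ 4 * (N%:R - 2) ^+ 4 * bieval U (p t) (q t) ^+ 2
        * bieval (covS N U) (p t) (q t) * bieval (covPhi N U) (p t) (q t)
      - N%:R ^+ 6 * (N%:R - 2) ^+ 6 * bieval U (p t) (q t) ^+ 3
        * bieval (covT N U) (p t) (q t).
Proof.
have [_ /(_ t ht) [hq hp]] := hpq.
eexists; split; first exact: derivative_within_bieval hp hq.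
exact: covPhi_flow_syzygy (ltnW hN) hU.
Qed.
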